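(* There exist a polynomial $p$ and a constant $c>0$ such that for every integer $k\geq 1$ there exist an approval election $E=(N,C,(A_v)_{v\in N},k)$ with $|N|\le p(k)$ voters, a linear order $<$ on $C$, and a committee $W_0\subseteq C$ with $|W_0|=k$, such that running the local search algorithm $0^+$-ls-PAV with lexicographic better response (with respect to $<$) starting from $W_0$ performs at least $c\,k^{\log k}$ swaps (i.e., $\Omega(k^{\log k})$ swaps) before terminating.
   Context: An approval election is a tuple $E=(N,C,(A_v)_{v\in N},k)$ where $N=[n]$ is a set of voters, $C$ is a finite set of candidates, $A_v\subseteq C$ is the approval ballot of voter $v$, and $k$ is the target committee size. The PAV score of a committee $W\subseteq C$ is $\textsc{pavsc}(W)=\sum_{v\in N}\sum_{j=1}^{|A_v\cap W|}\frac{1}{j}$, and for $a\in W$, $b\notin W$, $\Delta(W,a,b)=\textsc{pavsc}((W\setminus\{a\})\cup\{b\})-\textsc{pavsc}(W)$. The algorithm $\varepsilon$-ls-PAV starts from a size-$k$ committee $W$ and, while there exist $a\in W$, $b\notin W$ with $\Delta(W,a,b)\ge\varepsilon$, replaces $W$ by $(W\cup\{b\})\setminus\{a\}$; it returns $W$ when no such pair exists. $0^+$-ls-PAV denotes $\varepsilon$-ls-PAV with $\varepsilon=1/\mathrm{lcm}(1,2,\dots,k)$, which is equivalent to performing a swap exactly when $\Delta(W,a,b)>0$. Lexicographic better response with respect to a linear order $<$ on $C$ selects the swap as follows: iterate over the candidates $b\in C\setminus W$ in increasing order of $<$, and for each such $b$ iterate over the candidates $a\in W$ in increasing order of $<$;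 perform the first swap $(a,b)$ encountered with $\Delta(W,a,b)>0$. Here $\log$ denotes the base-2 logarithm. *)

(* Defs.v *)
From Stdlib Require Import Reals.
From mathcomp Require Import all_boot all_order all_algebra.
Set Implicit Arguments. Unset Strict Implicit. Unset Printing Implicit Defensive.
Import Order.TTheory GRing.Theory Num.Theory.

Local Open Scope ring_scope.

Definition harm (t : nat) : rat := \sum_(j < t) (j.+1%:R)^-1.

(* Election with voters N = 'I_n and candidates C = 'I_m;
   A v is the approval ballot of voter v. *)
Definition pavsc (n m : nat) (A : 'I_n -> {set 'I_m}) (W : {set 'I_m}) : rat :=
  \sum_(v < n) harm #|A v :&: W|.

Definition swap_set (m : nat) (W : {set 'I_m}) (a b : 'I_m) : {set 'I_m} :=
  (W :|: [set b]) :\ a.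

Definition pav_delta (n m : nat) (A : 'I_n -> {set 'I_m}) (W : {set 'I_m})
  (a b : 'I_m) : rat :=
  pavsc A (swap_set W a b) - pavsc A W.

(* The linear order < on C is given by the list L enumerating C in increasing
   order (perm_eq L (enum 'I_m)).  Candidate swaps are listed with b (outside W)
   as the outer loop and a (inside W) as the inner loop, both increasing in <. *)
Definition lex_pairs (m : nat) (L : seq 'I_m) (W : {set 'I_m}) : seq ('I_m * 'I_m) :=
  [seq (a, b) | b <- [seq b <- L | b \notin W], a <- [seq a <- L | a \in W]].

Definition lex_step (n m : nat) (A : 'I_n -> {set 'I_m}) (L : seq 'I_m)
  (W : {set 'I_m}) : option {set 'I_m} :=
  match ohead [seq ab <- lex_pairs L W | 0 < pav_delta A W ab.1 ab.2] with
  | Some (a, b) => Some (swap_set W a b)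
  | None => None
  end.

Fixpoint lex_run (n m : nat) (A : 'I_n -> {set 'I_m}) (L : seq 'I_m)
  (t : nat) (W0 : {set 'I_m}) : option {set 'I_m} :=
  match t with
  | 0 => Some W0
  | t'.+1 => obind (lex_step A L) (lex_run A L t' W0)
  end.

Definition performs_at_least (n m : nat) (A : 'I_n -> {set 'I_m}) (L : seq 'I_m)
  (W0 : {set 'I_m}) (t : nat) : Prop :=
  lex_run A L t W0 <> None.

Definition k_pow_logk (k : nat) : R :=
  Rpower (INR k) (Rdiv (ln (INR k)) (ln 2)).

(* Main.v *)
(* All but one of the k seats are held by "anchors", each protected by enough
   voters approving only it that swapping it out never pays.  The remaining seat
   is passed along a chain of "movers" c_0, ..., c_Q listed in increasing order.
   A voter approving j anchors contributes 1/(j+1) to the marginal score of a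
   mover it approves, so c_s can be given any marginal score that is a sum of
   unit fractions 1/1, ..., 1/k with at most k copies of each.  The entries
   1/((n+1) C(n,h)) of Leibniz' harmonic triangle are integer combinations of
   1/1, ..., 1/(n+1); hence, with Q := k C(k-1, (k-1)/2) and reducing the
   coefficient of 1/j modulo j, every s/Q + (k-1) with 0 <= s <= Q is such a sum.
   Lexicographic better response then moves from c_s to c_(s+1) for Q swaps,
   and Q grows exponentially in k. *)
Require Import Defs.
From Stdlib Require Import Reals.
From Stdlib Require Lra.
From mathcomp Require Import all_boot all_order all_algebra.
From mathcomp Require Import ring lra zify.
Set Implicit Arguments. Unset Strict Implicit. Unset Printing Implicit Defensive.
Import Order.TTheory GRing.Theory Num.Theory.

Local Open Scope ring_scope.

(** * Integer combinations of unit fractions *)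

Definition unit_frac_span (k : nat) (x : rat) : Prop :=
  exists a : nat -> int, x = \sum_(j < k) (a j)%:~R / j.+1%:R.

Lemma unit_frac_spanB k x y :
  unit_frac_span k x -> unit_frac_span k y -> unit_frac_span k (x - y).
Proof.
move=> [a ->] [b ->]; exists (fun j => a j - b j); rewrite -sumrB.
by apply: eq_bigr => j _; rewrite intrB mulrBl.
Qed.

Lemma unit_frac_spanMn k x i : unit_frac_span k x -> unit_frac_span k (i%:R * x).
Proof.
move=> [a ->]; exists (fun j => i%:Z * a j); rewrite mulr_sumr.
by apply: eq_bigr => j _; rewrite intrM mulrA.
Qed.

Lemma unit_frac_spanS k x : unit_frac_span k x -> unit_frac_span k.+1 x.
Proof.
move=> [a ->]; exists (fun j => if (j < k)%N then a j else 0).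
rewrite big_ord_recr /= ltnn mul0r addr0.
by apply: eq_bigr => j _; rewrite ltn_ord.
Qed.

Lemma unit_frac_span_inv n : unit_frac_span n.+1 (n.+1%:R)^-1.
Proof.
exists (fun j => (j == n)%:Z); rewrite big_ord_recr /= eqxx mul1r big1 ?add0r //.
by move=> j _; rewrite ltn_eqF ?ltn_ord // mul0r.
Qed.

(** Both binomials in row [n.+1] are rational multiples of ['C(n, h)]; once they are expressed that
    way, the identity reduces to n+2 = (h+1) + (n+1-h). *)
Lemma leibniz_triangle n h : (h <= n)%N ->
  ((n.+2 * 'C(n.+1, h.+1))%:R)^-1 =
  ((n.+1 * 'C(n, h))%:R)^-1 - ((n.+2 * 'C(n.+1, h))%:R)^-1 :> rat.
Proof.
move=> hn.
have cS : n.+1%:R * 'C(n, h)%:R = h.+1%:R * 'C(n.+1, h.+1)%:R :> rat.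
  by rewrite -!natrM (mul_bin_diag n.+1).
have cN : n.+1%:R * 'C(n, h)%:R = (n.+1 - h)%:R * 'C(n.+1, h)%:R :> rat.
  by rewrite -!natrM (mul_bin_down n.+1).
have c0 : 'C(n, h)%:R != 0 :> rat by rewrite pnatr_eq0 -lt0n bin_gt0.
have h0 : h.+1%:R != 0 :> rat by rewrite pnatr_eq0.
have n1 : n.+1%:R != 0 :> rat by rewrite pnatr_eq0.
have n2 : n.+2%:R != 0 :> rat by rewrite pnatr_eq0.
have r0 : (n.+1 - h)%:R != 0 :> rat by rewrite pnatr_eq0 -lt0n subn_gt0.
have n2E : n.+2%:R = h.+1%:R + (n.+1 - h)%:R :> rat by rewrite -natrD; congr (_%:R); lia.
rewrite !natrM; move: cS cN n2E => /esym/(canRL (mulKf h0)) -> /esym/(canRL (mulKf r0)) ->.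
move: n2 n1 r0 h0 c0.
move: (n.+2%:R) (n.+1%:R) ((_ - _)%N%:R) (h.+1%:R) ('C(_, _)%:R) => a b c d x.
move=> a0 b0 c0 d0 x0 aE; rewrite aE in a0 *.
by field; rewrite a0 b0 c0 d0 x0.
Qed.

(** Induction on the column [h]: border entries are themselves unit fractions, and any other entry
    is a difference of two entries of the preceding column in rows at most [n]. *)
Lemma unit_frac_span_leibniz h n : (h <= n)%N ->
  unit_frac_span n.+1 ((n.+1 * 'C(n, h))%:R)^-1.
Proof.
elim: h n => [|h IH] [|n] // hn; rewrite ?bin0 ?muln1; try exact: unit_frac_span_inv.
rewrite leibniz_triangle //; apply: unit_frac_spanB; last by apply: IH; rewrite leqW.
by apply: unit_frac_spanS; apply: IH.
Qed.

(** Reducing each coefficient modulo its denominator changes the sum by an integer [z]. The reduced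
    coefficient of 1/1 is 0 and the other [K] terms lie in [0, 1), so [z + K] lies between 0 and
    [K.+1] and can serve as the coefficient of 1/1. *)
Lemma unit_frac_span_count K x : unit_frac_span K.+1 x -> 0 <= x <= 1 ->
  exists2 r : nat -> nat, (forall j, (j < K.+1)%N -> (r j <= K.+1)%N) &
    \sum_(j < K.+1) (r j)%:R / j.+1%:R = x + K%:R.
Proof.
move=> [a xE] /andP[x_ge0 x_le1].
pose f j := (a j %% j.+1%:Z)%Z; pose z : int := \sum_(j < K.+1) (a j %/ j.+1%:Z)%Z.
have f_ge0 j : 0 <= f j by rewrite modz_ge0.
have f_lt j : f j < j.+1%:Z by rewrite ltz_pmod.
pose S : rat := \sum_(j < K) (f j.+1)%:~R / j.+2%:R.
have f0 : f 0%N = 0 by rewrite /f modz1.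
have xzS : x = z%:~R + S.
  rewrite xE.
  have -> : S = \sum_(j < K.+1) (f j)%:~R / j.+1%:R.
    by rewrite [RHS]big_ord_recl /= f0 mul0r add0r.
  rewrite /z rmorph_sum -big_split; apply: eq_bigr => j _ /=.
  rewrite {1}(divz_eq (a j) j.+1%:Z) intrD intrM mulrDl mulfK //.
  by rewrite pnatr_eq0.
have S_ge0 : 0 <= S.
  by apply: sumr_ge0 => j _; rewrite divr_ge0 ?ler0n // ler0z.
have S_leK : S <= K%:R.
  have -> : K%:R = \sum_(j < K) (1 : rat) by rewrite sumr_const card_ord.
  apply: ler_sum => j _; rewrite ler_pdivrMr ?ltr0n // mul1r.
  by apply: ltW; rewrite -[j.+2%:R]/(j.+2%:Z%:~R) ltr_int.
have z_ge : 0 <= z + K%:Z.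
  rewrite -(ler_int rat) intrD; change (0 <= z%:~R + K%:R :> rat); lra.
have z_le : z + K%:Z <= K.+1%:Z.
  rewrite -(ler_int rat) intrD -addn1 PoszD intrD; change (z%:~R + K%:R <= K%:R + 1 :> rat); lra.
exists (fun j => if j is 0%N then absz (z + K%:Z) else `|f j|%N).
  move=> [_|j jK]; first by rewrite -lez_nat gez0_abs.
  rewrite -lez_nat gez0_abs //; apply: ltW; apply: lt_le_trans (f_lt _) _.
  by rewrite lez_nat.
rewrite big_ord_recl /= divr1 natr_absz ger0_norm // intrD.
have -> : \sum_(i < K) (`|f (bump 0 i)|%N)%:R / (bump 0 i).+1%:R = S :> rat.
  by apply: eq_bigr => j _; rewrite natr_absz ger0_norm.
by rewrite xzS addrAC.
Qed.

(** * Growth of central binomials *)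

Lemma leq_binSl n m : ('C(n, m) <= 'C(n.+1, m))%N.
Proof. by case: m => [|m]; rewrite ?bin0 // binS leq_addr. Qed.

(** Pascal's rule splits C(2h+2, h+1) into two terms, each at least C(2h, h). The offset [e] makes
    odd rows available. *)
Lemma leq_exp2_bin h e : (2 ^ h <= 'C(h + h + e, h))%N.
Proof.
elim: e => [|e IH]; last by rewrite addnS; apply: leq_trans IH (leq_binSl _ _).
rewrite addn0; elim: h => // h IH.
rewrite addSn addnS binS expnS mul2n -addnn; apply: leq_add.
  by apply: leq_trans IH _; rewrite binS leq_addl.
exact: leq_trans IH (leq_binSl _ _).
Qed.

(** * PAV scores and single lexicographic steps *)

Lemma pavscU1 n m (A : 'I_n -> {set 'I_m}) (F : {set 'I_m}) b : b \notin F ->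
  pavsc A (b |: F) =
  pavsc A F + \sum_(v < n | b \in A v) (#|A v :&: F|.+1%:R)^-1.
Proof.
move=> bF; rewrite /pavsc [X in _ + X]big_mkcond -big_split; apply: eq_bigr => v _ /=.
rewrite setIUr; case: ifP => bA.
  have -> : A v :&: [set b] = [set b].
    by apply/setIidPr; rewrite sub1set.
  by rewrite cardsU1 inE (negbTE bF) andbF /harm big_ord_recr.
have -> : A v :&: [set b] = set0.
  by apply/setP => x; rewrite !inE; case: eqP => [->|]; rewrite ?bA ?andbF.
by rewrite set0U addr0.
Qed.

Lemma harm_le s t : (s <= t)%N -> harm s <= harm t.
Proof.
move=> /subnK <-; elim: (t - s)%N => // d IH.
rewrite addSn /harm big_ord_recr /=; apply: le_trans IH _.
by rewrite lerDl invr_ge0.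
Qed.

Lemma harm_leS s t : (s <= t.+1)%N -> harm s <= harm t + 1.
Proof.
move=> /harm_le st; apply: le_trans st _.
by rewrite /harm big_ord_recr /= lerD2l invf_le1 ?ltr0n // ler1n.
Qed.

(** The outer loop finds nothing before [b]. At [b] the improving partners form a nonempty list
    containing only [a], so the position of [a] in the order is irrelevant. *)
Lemma lex_step_first n m (A : 'I_n -> {set 'I_m}) (L1 L2 : seq 'I_m) (W : {set 'I_m}) a b :
    a \in L1 ++ b :: L2 -> a \in W -> b \notin W -> 0 < pav_delta A W a b ->
    (forall a', a' \in W -> 0 < pav_delta A W a' b -> a' = a) ->
    (forall a' b', b' \in L1 -> b' \notin W -> a' \in W -> pav_delta A W a' b' <= 0) ->
  lex_step A (L1 ++ b :: L2) W = Some (swap_set W a b).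
Proof.
move=> aL aW bW dab uniq_a nimp.
rewrite /lex_step /lex_pairs [X in flatten (map _ X)]filter_cat map_cat flatten_cat filter_cat.
set la := filter (fun a => a \in W) _.
set s1 := filter _ (flatten _).
have -> : s1 = [::].
  apply/eqP; rewrite -(negbK (_ == _)) -has_filter; apply/hasPn => ab.
  case/allpairsPdep => b' [a' []]; rewrite !mem_filter => /andP[b'W b'L] /andP[a'W _] -> /=.
  by rewrite -leNgt nimp.
rewrite /= bW /= filter_cat filter_map.
set s2 := filter _ la.
have as2 : a \in s2 by rewrite !mem_filter /= dab aW.
have : all (pred1 a) s2.
  apply/allP => x; rewrite !mem_filter /= => /and3P[dx xW _].
  by rewrite (uniq_a x).
by case: s2 as2 => // x s2 _ /= /andP[/eqP -> _].
Qed.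

Lemma lex_run_chain n m (A : 'I_n -> {set 'I_m}) L (W : nat -> {set 'I_m}) T :
  (forall s, (s < T)%N -> lex_step A L (W s) = Some (W s.+1)) ->
  lex_run A L T (W 0%N) = Some (W T).
Proof.
elim: T => // T IH step /=; rewrite IH /= ?step // => s sT.
by rewrite step // ltnW.
Qed.

(** From [l = 8] on the exponential dominates by itself; the summand 64 covers the smaller cases and
    reappears as the constant 2^-64 of the theorem. *)
Lemma double_square_le_exp2 l : (2 * l.+1 ^ 2 <= 64 + 2 ^ l)%N.
Proof.
have [l7|l8] := leqP l 7; first by do 8! (case: l l7 => [//|l l7]).
have: (2 * l.+1 ^ 2 <= 2 ^ l)%N.
  rewrite -(subnK l8); elim: (l - 8)%N => // d IH.
  rewrite addSn [leqRHS]expnS leq_mul2l /=; apply: leq_trans IH.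
  by rewrite -!mulnn; nia.
lia.
Qed.

(** * The election and its chain of swaps *)

Section Election.

Variables (K Q : nat) (r : 'I_Q.+1 -> nat -> nat).
Hypothesis r_le : forall s (j : 'I_K.+1), (r s j <= K.+1)%N.

(* Voter [inl (j, i)] is the i-th copy of weight 1/(j+1); voter [inr (f, _)]
   protects anchor f. *)
Definition voter : finType :=
  ('I_K.+1 * 'I_K.+1 + 'I_K * ('I_K.+1 * 'I_K.+1))%type.

Definition mover (s : 'I_Q.+1) : 'I_(Q.+1 + K) := lshift K s.
Definition anchor (i : 'I_K) : 'I_(Q.+1 + K) := rshift Q.+1 i.
Definition anchors : {set 'I_(Q.+1 + K)} := [set anchor i | i : 'I_K].

(** For each [j], exactly [r s j] of the [K.+1] copies approve mover [s], each together with [j]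
    anchors; this gives the mover the marginal score of [pavsc_mover]. *)
Definition ballot (v : voter) : {set 'I_(Q.+1 + K)} :=
  match v with
  | inl (j, i) => [set x | match split x with
                           | inl s => (i < r s j)%N
                           | inr f => (f < j)%N
                           end]
  | inr (f, _) => [set anchor f]
  end.

Definition profile (v : 'I_#|voter|) := ballot (enum_val v).

Lemma anchor_inj : injective anchor. Proof. exact: rshift_inj. Qed.

Lemma mover_inj : injective mover. Proof. exact: lshift_inj. Qed.

Lemma anchorF i : anchor i \in anchors.
Proof. by apply/imsetP; exists i. Qed.

Lemma mover_neq_anchor s i : (mover s == anchor i) = false.
Proof. exact: eq_lrshift. Qed.

Lemma moverF s : mover s \notin anchors.
Proof. by apply/imsetP => -[i _ /eqP]; rewrite mover_neq_anchor. Qed.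

Lemma mover_ballotl s j i : (mover s \in ballot (inl (j, i))) = (i < r s j)%N.
Proof. by rewrite inE (unsplitK (inl s)). Qed.

Lemma mover_ballotr s w : (mover s \in ballot (inr w)) = false.
Proof. by case: w => f w; rewrite inE mover_neq_anchor. Qed.

Lemma candidateP x : (exists s, x = mover s) \/ (exists i, x = anchor i).
Proof.
rewrite -(splitK x); case: (split x) => [s|i]; first by left; exists s.
by right; exists i.
Qed.

Lemma card_ballot_anchors j i : #|ballot (inl (j, i)) :&: anchors| = j.
Proof.
have -> : ballot (inl (j, i)) :&: anchors = anchor @: [set f : 'I_K | (f < j)%N].
  apply/setP => x; rewrite !inE; have [[s ->]|[f ->]] := candidateP x.
    rewrite (negbTE (moverF s)) andbF; apply/esym/imsetP => -[f _ /eqP].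
    by rewrite mover_neq_anchor.
  by rewrite (unsplitK (inr f)) anchorF andbT mem_imset ?inE //; exact: anchor_inj.
rewrite card_imset; last exact: anchor_inj.
have jK : (j <= K)%N by rewrite -ltnS.
by rewrite cardsE -sum1_card (big_ord_narrow jK) sum1_card card_ord.
Qed.

Lemma pavsc_profileE W : pavsc profile W = \sum_(v : voter) harm #|ballot v :&: W|.
Proof. by rewrite [RHS]big_enum_val. Qed.

Lemma pavsc_mover s :
  pavsc profile (mover s |: anchors) =
  pavsc profile anchors + \sum_(j < K.+1) (r s j)%:R / j.+1%:R.
Proof.
rewrite pavscU1 ?moverF //; congr (_ + _).
rewrite big_mkcond /=.
transitivity (\sum_(v : voter) if mover s \in ballot v
   then (#|ballot v :&: anchors|.+1%:R)^-1 else 0 : rat).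
  by rewrite [RHS]big_enum_val.
(* Protecting voters approve no mover and contribute nothing. *)
rewrite big_sumType /= [X in _ + X]big1 ?addr0 => [|w _]; last first.
  by rewrite mover_ballotr.
transitivity (\sum_(j < K.+1) \sum_(i < K.+1)
    if (i < r s j)%N then (j.+1%:R)^-1 else 0 : rat).
  rewrite pair_bigA; apply: eq_bigr => -[j i] _.
  by rewrite mover_ballotl card_ballot_anchors.
apply: eq_bigr => j _.
rewrite -big_mkcond /= (big_ord_narrow (r_le s j)) sumr_const card_ord.
by rewrite mulr_natl.
Qed.

Lemma swap_mover s t : s != t ->
  swap_set (mover s |: anchors) (mover s) (mover t) = mover t |: anchors.
Proof.
move=> st; apply/setP => x; rewrite !inE.
have [->|xs] /= := eqVneq x (mover s); last by rewrite orbC.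
by rewrite (negbTE (moverF s)) orbF (inj_eq mover_inj) (negbTE st).
Qed.

Lemma pav_delta_mover s t : s != t ->
  pav_delta profile (mover s |: anchors) (mover s) (mover t) =
  \sum_(j < K.+1) (r t j)%:R / j.+1%:R - \sum_(j < K.+1) (r s j)%:R / j.+1%:R.
Proof. by move=> st; rewrite /pav_delta swap_mover // !pavsc_mover; ring. Qed.

(* Each anchor has as many protecting voters as there are voters of the first
   kind, and the latter gain at most 1 each. *)
Lemma pav_delta_anchor (W : {set 'I_(Q.+1 + K)}) i t : anchor i \in W ->
  pav_delta profile W (anchor i) (mover t) <= 0.
Proof.
move=> iW; rewrite /pav_delta !pavsc_profileE -sumrB.
pose g (v : voter) : rat := match v with inl _ => 1 | inr w => - (w.1 == i)%:R end.
apply: (@le_trans _ _ (\sum_v g v)).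
  apply: ler_sum => -[w|[f w]] _; rewrite /g lerBlDr.
    rewrite addrC; apply: harm_leS.
    apply: (@leq_trans #|mover t |: (ballot (inl w) :&: W)|).
      apply/subset_leq_card/subsetP => x; rewrite !inE.
      by case/and3P => -> _ /orP[->|->]; rewrite ?orbT.
    by rewrite cardsU1; case: (_ \notin _).
  have [->|fi] /= := eqVneq f i.
    have -> : [set anchor i] :&: swap_set W (anchor i) (mover t) = set0.
      by apply/setP => x; rewrite !inE; case: eqP.
    have -> : [set anchor i] :&: W = [set anchor i].
      by apply/setIidPl; rewrite sub1set.
    by rewrite cards0 cards1 /harm big_ord0 big_ord1 invr1 addNr.
  rewrite oppr0 add0r; apply/harm_le/subset_leq_card/subsetP => x; rewrite !inE.
  by case/and3P => /eqP-> _ /orP[->|]; rewrite ?eqxx // eq_sym mover_neq_anchor.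
rewrite big_sumType /=.
rewrite -(pair_bigA _ (fun f (w : 'I_K.+1 * 'I_K.+1) => - (f == i)%:R : rat)) /=.
rewrite (bigD1 i) //= [X in _ + (_ + X)]big1 => [|f /negbTE->]; last first.
  by apply: big1 => w _; rewrite oppr0.
by rewrite eqxx sumrN addr0 subrr.
Qed.

Hypothesis r_mono : forall s t : 'I_Q.+1,
  (\sum_(j < K.+1) (r s j)%:R / j.+1%:R < \sum_(j < K.+1) (r t j)%:R / j.+1%:R :> rat)
  = (s < t)%N.

(** Movers preceding [t] have index at most [s], hence no larger score, and dropping an anchor never
    pays; so [t] is the first entrant that improves, and only [s] can leave. *)
Lemma lex_step_mover (s t : 'I_Q.+1) : t = s.+1 :> nat ->
  lex_step profile (enum 'I_(Q.+1 + K)) (mover s |: anchors) = Some (mover t |: anchors).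
Proof.
move=> tE.
have st : s != t by rewrite -val_eqE /= tE ltn_eqF.
have -> : enum 'I_(Q.+1 + K) =
    take (mover t) (enum 'I_(Q.+1 + K)) ++ mover t :: drop (mover t).+1 (enum 'I_(Q.+1 + K)).
  rewrite -[X in _ ++ X :: _](nth_ord_enum (mover t) (mover t)) -drop_nth ?cat_take_drop //.
  by rewrite size_enum_ord.
rewrite -(swap_mover st); apply: lex_step_first.
- rewrite -[X in _ ++ X :: _](nth_ord_enum (mover t) (mover t)) -drop_nth ?cat_take_drop //.
    by rewrite mem_enum.
  by rewrite size_enum_ord.
- by rewrite !inE eqxx.
- by rewrite !inE (negbTE (moverF t)) orbF (inj_eq mover_inj) eq_sym.
- by rewrite pav_delta_mover // subr_gt0 r_mono tE.
- move=> a; rewrite !inE => /orP[/eqP //|/imsetP[i _ ->]].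
  by rewrite ltNge pav_delta_anchor // !inE anchorF orbT.
move=> a b bL; rewrite !inE negb_or => /andP[bs bF] aW.
have {bF} [u bE] : exists u, b = mover u.
  have [//|[i bE]] := candidateP b.
  by rewrite bE anchorF in bF.
have us : u != s by apply: contraNneq bs => <-; rewrite bE.
(* Movers occupy the initial positions of the enumeration, so lying in the prefix before [mover t]
   bounds the index. *)
have ult : (u < t)%N.
  have := map_f val bL; rewrite map_take val_enum_ord take_iota mem_iota bE /= add0n.
  by rewrite leq_min => /andP[].
rewrite {}bE in bL bs *.
case/orP: aW => [/eqP->|/imsetP[i _ ->]]; last by rewrite pav_delta_anchor // !inE anchorF orbT.
rewrite pav_delta_mover 1?eq_sym // subr_le0 leNgt r_mono -leqNgt.
by rewrite -ltnS -tE.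
Qed.

Lemma performs_movers :
  performs_at_least profile (enum 'I_(Q.+1 + K)) (mover ord0 |: anchors) Q.
Proof.
rewrite /performs_at_least.
(* Indexing the chain by naturals is harmless: [inord] is only applied to values at most [Q]. *)
have -> : ord0 = inord 0 :> 'I_Q.+1 by apply/val_inj; rewrite /= inordK.
rewrite (lex_run_chain (W := fun s => mover (inord s) |: anchors)) // => s sQ.
by apply: lex_step_mover; rewrite !inordK // ltnS ltnW.
Qed.

Lemma card_mover_anchors s : #|mover s |: anchors| = K.+1.
Proof.
by rewrite cardsU1 moverF card_imset ?card_ord //; exact: anchor_inj.
Qed.

Lemma card_voter : #|voter| = (K.+1 ^ 3)%N.
Proof. by rewrite card_sum !card_prod !card_ord !expnS expn0 muln1 mulSn. Qed.

End Election.

(** * Comparison with k^(log k) *)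

Lemma INR_exp2 a : INR (2 ^ a) = pow 2 a.
Proof. by elim: a => // a IH; rewrite expnS mult_INR IH. Qed.

(** The left side is exp((ln k)^2 / ln 2), increasing in ln k since ln k is nonnegative, and ln k is
    at most l ln 2. *)
Lemma k_pow_logk_le k l : (0 < k)%N -> (k <= 2 ^ l)%N ->
  Rle (k_pow_logk k) (pow 2 (l ^ 2)).
Proof.
move=> k0 kl.
have ln2_gt0 : Rlt 0 (ln 2) by have := ln_lt_2; Lra.lra.
have k1 : Rle 1 (INR k) by apply: (le_INR 1); apply/ssrnat.leP.
have lnk_ge0 : Rle 0 (ln (INR k)).
  by rewrite -ln_1; case: k1 => [k1|<-]; [left; apply: ln_increasing; Lra.lra | right].
have lnk_le : Rle (ln (INR k)) (Rmult (INR l) (ln 2)).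
  rewrite -ln_pow; last by Lra.lra.
  rewrite -INR_exp2; have /ssrnat.leP/le_INR := kl.
  by case=> [kl'|->]; [left; apply: ln_increasing; Lra.lra | right].
rewrite -Rpower_pow; last by Lra.lra.
rewrite /k_pow_logk /Rpower; set x := ln (INR k) in lnk_ge0 lnk_le *.
have -> : INR (l ^ 2) = Rmult (INR l) (INR l) by rewrite -mulnn mult_INR.
have le2 : Rle (Rmult (Rdiv x (ln 2)) x) (Rmult (Rmult (INR l) (INR l)) (ln 2)).
  have q_le : Rle (Rdiv x (ln 2)) (INR l).
    by apply: (Rmult_le_reg_r (ln 2)) => //; rewrite /Rdiv Rmult_assoc Rinv_l; Lra.lra.
  rewrite Rmult_assoc; apply: Rmult_le_compat => //.
  by apply: Rmult_le_pos => //; left; apply: Rinv_0_lt_compat.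
by case: le2 => [lt2|->]; [left; apply: exp_increasing | right].
Qed.

Theorem theorem9 :
  exists (p : {poly rat}) (c : R), Rlt 0 c /\
    forall k : nat, (1 <= k)%N ->
      exists (n m : nat) (A : 'I_n -> {set 'I_m}) (L : seq 'I_m) (W0 : {set 'I_m}),
        perm_eq L (enum 'I_m) /\
        #|W0| = k /\
        (n%:R <= p.[k%:R])%R /\
        exists t : nat, performs_at_least A L W0 t /\ Rle (Rmult c (k_pow_logk k)) (INR t).
Proof.
exists 'X^3, (Rinv (pow 2 64)); split; first by apply/Rinv_0_lt_compat/pow_lt; Lra.lra.
case=> // K _; pose h := K./2; pose Q := (K.+1 * 'C(K, h))%N.
have hK : (h <= K)%N by rewrite /h; lia.
have Q0 : (0 < Q)%N by rewrite muln_gt0 bin_gt0.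
have Qge : (2 ^ h <= Q)%N.
  apply: leq_trans (leq_pmull _ _) => //.
  by have := leq_exp2_bin h (odd K); rewrite addnn addnC odd_double_half.
(* Since 1/Q is an entry of the Leibniz triangle, every s/Q is in the span, and it lies in [0, 1]
   because [s] is at most [Q]. *)
have /fin_all_exists2[r r_le r_sum] (s : 'I_Q.+1) :
    exists2 r : nat -> nat, (forall j, (j < K.+1)%N -> (r j <= K.+1)%N) &
      \sum_(j < K.+1) (r j)%:R / j.+1%:R = s%:R / Q%:R + K%:R :> rat.
  apply: unit_frac_span_count.
    exact/unit_frac_spanMn/unit_frac_span_leibniz.
  rewrite divr_ge0 ?ler0n //= ler_pdivrMr ?ltr0n // mul1r ler_nat.
  by rewrite -ltnS.
exists #|voter K|, (Q.+1 + K)%N, (profile r), (enum 'I_(Q.+1 + K)).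
exists (mover K ord0 |: anchors K Q); split; first exact: perm_refl.
split; first exact: card_mover_anchors.
split; first by rewrite hornerXn card_voter natrX.
exists Q; split.
  apply: performs_movers => [s j|s t]; first exact: r_le.
  by rewrite !r_sum ltrD2r ltr_pM2r ?invr_gt0 ?ltr0n // ltr_nat.
pose l := trunc_log 2 K.+1.
have lK : (2 ^ l <= K.+1)%N by rewrite trunc_logP.
have Kl : (K.+1 <= 2 ^ l.+1)%N by rewrite ltnW // trunc_log_ltn.
(* This yields k^(log k) <= 2^((l+1)^2) <= 2^64 * 2^h <= 2^64 * Q. *)
have l_le : (l.+1 ^ 2 <= 64 + h)%N.
  by have := double_square_le_exp2 l; rewrite /h; lia.
have pos64 : Rlt 0 (pow 2 64) by apply: pow_lt; Lra.lra.
apply: (Rmult_le_reg_l (pow 2 64)) => //.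
rewrite -Rmult_assoc Rinv_r; last by Lra.lra.
rewrite Rmult_1_l; apply: Rle_trans (k_pow_logk_le _ Kl) _ => //.
apply: Rle_trans (Rle_pow 2 _ (64 + h) _ _) _; first Lra.lra.
  by apply/ssrnat.leP.
rewrite Rdef_pow_add; apply: Rmult_le_compat_l; first Lra.lra.
by rewrite -INR_exp2; apply/le_INR/ssrnat.leP.
Qed.
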